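(* Let $(X,\mathbb{A},d)$ be a $C^{\ast}$-algebra valued metric space and let $C_{x_0,r}^{C^{\ast}}$ be any circle on $X$ (with $x_0\in X$, $r\in\mathbb{A}_+$). Define $\varphi:X\to\mathbb{A}_+$ by $\varphi(x)=d(x,x_0)$ for all $x\in X$. Let $T:X\to X$ be a self-mapping. Then $T$ satisfies $$A^{\ast}d(x,Tx)A\preceq \varphi(x)-\varphi(Tx)\qquad\text{for all }x\in X,$$ where $A\in\mathbb{A}$ is an invertible element with $\|A^{-1}\|<1$, if and only if $T$ fixes the circle $C_{x_0,r}^{C^{\ast}}$ and $T=I_X$.
   Context: $\mathbb{A}$ is a unital $C^{\ast}$-algebra with unit $I$ and zero element $\theta$. $\mathbb{A}_h=\{a\in\mathbb{A}: a=a^{\ast}\}$. An element $a\in\mathbb{A}$ is positive, written $\theta\preceq a$, if $a\in\mathbb{A}_h$ and its spectrum is contained in $[0,\infty)$; $\mathbb{A}_+$ is the set of positive elements (so $\theta\in\mathbb{A}_+$). For $a,b\in\mathbb{A}_h$, $a\preceq b$ means $b-a\in\mathbb{A}_+$. A $C^{\ast}$-algebra valued metric space $(X,\mathbb{A},d)$ is a nonempty set $X$ with a map $d:X\times X\to\mathbb{A}$ such that for all $x,y,z\in X$: (i) $\theta\preceq d(x,y)$, and $d(x,y)=\theta$ if and only if $x=y$; (ii) $d(x,y)=d(y,x)$; (iii) $d(x,y)\preceq d(x,z)+d(z,y)$. For $x_0\in X$ and $r\in\mathbb{A}_+$, the circle with center $x_0$ and radius $r$ is $C_{x_0,r}^{C^{\ast}}=\{x\in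 X: d(x,x_0)=r\}$. A self-mapping $T:X\to X$ fixes the circle $C_{x_0,r}^{C^{\ast}}$ if $Tx=x$ for all $x\in C_{x_0,r}^{C^{\ast}}$. $I_X$ denotes the identity map of $X$. *)

(* Defs.v *)
(* World: MathComp / MathComp-Analysis. *)
From HB Require Import structures.
From mathcomp Require Import all_boot all_order all_algebra.
From mathcomp Require Import complex.
From mathcomp Require Import all_classical all_reals all_analysis.

Set Implicit Arguments.
Unset Strict Implicit.
Unset Printing Implicit Defensive.

Import Order.TTheory GRing.Theory Num.Theory.
Import numFieldNormedType.Exports.
Local Open Scope classical_set_scope.
Local Open Scope complex_scope.
Local Open Scope ring_scope.

(* Unital C*-algebras over the complex field R[i].  The norm of a
   normedModType over R[i] takes its values in R[i], in which x <= y means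
   that y - x is a nonnegative real.  The structure is a plain record over a
   Banach space: Hierarchy-Builder refuses a structure joining a normed space
   and a ring, because numDomainType already joins the two in another way. *)
Record cstarAlgType (R : realType) := CStarAlgType {
  cstar_banach : completeNormedModType R[i] ;
  cstar_one : cstar_banach ;
  cstar_mul : cstar_banach -> cstar_banach -> cstar_banach ;
  cstar_star : cstar_banach -> cstar_banach ;
  cstar_mulA : associative cstar_mul ;
  cstar_mul1l : left_id cstar_one cstar_mul ;
  cstar_mul1r : right_id cstar_one cstar_mul ;
  cstar_mulDl : left_distributive cstar_mul +%R ;
  cstar_mulDr : right_distributive cstar_mul +%R ;
  cstar_one_neq0 : cstar_one != 0 ;
  cstar_scaleAl : forall (l : R[i]) a b,
    l *: cstar_mul a b = cstar_mul (l *: a) b ;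
  cstar_scaleAr : forall (l : R[i]) a b,
    l *: cstar_mul a b = cstar_mul a (l *: b) ;
  cstar_normM : forall a b, `|cstar_mul a b| <= `|a| * `|b| ;
  cstar_starK : involutive cstar_star ;
  cstar_starD : {morph cstar_star : a b / a + b} ;
  cstar_starZ : forall (l : R[i]) a, cstar_star (l *: a) = l^* *: cstar_star a ;
  cstar_starM : forall a b,
    cstar_star (cstar_mul a b) = cstar_mul (cstar_star b) (cstar_star a) ;
  cstar_normE : forall a, `|cstar_mul (cstar_star a) a| = `|a| ^+ 2
}.

Definition cstar_sort (R : realType) (A : cstarAlgType R) : Type :=
  cstar_banach A.
Coercion cstar_sort : cstarAlgType >-> Sortclass.

Section CStarInstances.
Variables (R : realType) (A : cstarAlgType R).

HB.instance Definition _ := CompleteNormedModule.copy A (cstar_banach A).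

HB.instance Definition _ := GRing.Zmodule_isNzRing.Build A
  (@cstar_mulA R A) (@cstar_mul1l R A) (@cstar_mul1r R A)
  (@cstar_mulDl R A) (@cstar_mulDr R A) (@cstar_one_neq0 R A).

HB.instance Definition _ :=
  GRing.Lmodule_isLalgebra.Build R[i] A (@cstar_scaleAl R A).

HB.instance Definition _ :=
  GRing.Lalgebra_isAlgebra.Build R[i] A (@cstar_scaleAr R A).

Definition cstar_is_inv (a b : A) : Prop := b * a = 1 /\ a * b = 1.

Definition cstar_unit : pred A := fun a => `[< exists b, cstar_is_inv a b >].

Definition cstar_inv (a : A) : A := xget a (cstar_is_inv a).

Lemma cstar_invP a : cstar_unit a -> cstar_is_inv a (cstar_inv a).
Proof. by move=> /asboolP[b ab]; exact: (xgetPex a (ex_intro _ b ab)). Qed.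

Lemma cstar_mulVr : {in cstar_unit, left_inverse 1 cstar_inv *%R}.
Proof. by move=> a /cstar_invP[]. Qed.

Lemma cstar_mulrV : {in cstar_unit, right_inverse 1 cstar_inv *%R}.
Proof. by move=> a /cstar_invP[]. Qed.

Lemma cstar_unitP a b : b * a = 1 /\ a * b = 1 -> cstar_unit a.
Proof. by move=> ab; apply/asboolP; exists b. Qed.

Lemma cstar_inv_out : {in [predC cstar_unit], cstar_inv =1 id}.
Proof.
move=> a /negP na; rewrite /cstar_inv; apply: xgetPN => b ab.
by apply: na; apply: cstar_unitP ab.
Qed.

HB.instance Definition _ := GRing.NzRing_hasMulInverse.Build A
  cstar_mulVr cstar_mulrV cstar_unitP cstar_inv_out.

Definition star (a : A) : A := cstar_star a.

End CStarInstances.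

Section CStarOrder.
Context {R : realType} {A : cstarAlgType R}.
Implicit Types a b : A.

Definition selfadjoint a : Prop := star a = a.

Definition spectrum a : set R[i] :=
  [set l | l%:A - a \isn't a GRing.unit].

Definition cstar_pos a : Prop :=
  selfadjoint a /\ spectrum a `<=` [set l | 0 <= l].

(* The order on selfadjoint elements; meaningful only for such a and b. *)
Definition cstar_le a b : Prop := cstar_pos (b - a).

End CStarOrder.

Section CStarMetric.
Context {R : realType} {A : cstarAlgType R} {X : Type}.
Implicit Types (d : X -> X -> A) (r : A).

Record cstar_metric d : Prop := {
  cstar_metric_inhabited : inhabited X ;
  cstar_metric_ge0 : forall x y, cstar_pos (d x y) ;
  cstar_metric_eq0 : forall x y, d x y = 0 <-> x = y ;
  cstar_metric_sym : forall x y, d x y = d y x ;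
  cstar_metric_triangle : forall x y z, cstar_le (d x y) (d x z + d z y)
}.

Definition cstar_circle d (x0 : X) r : set X := [set x | d x x0 = r].

Definition fixes_circle d (x0 : X) r (T : X -> X) : Prop :=
  forall x, cstar_circle d x0 r x -> T x = x.

End CStarMetric.

(* Main.v *)
Require Import Defs.
From HB Require Import structures.
From mathcomp Require Import all_boot all_order all_algebra.
From mathcomp Require Import complex ring lra.
From mathcomp Require Import all_classical all_reals all_analysis.

Set Implicit Arguments.
Unset Strict Implicit.
Unset Printing Implicit Defensive.

Import Order.TTheory GRing.Theory Num.Theory.
Import numFieldNormedType.Exports.
Local Open Scope classical_set_scope.
Local Open Scope ring_scope.

(** Fix x and put p = d x (T x).  Adding the triangle inequality
    phi x - phi (T x) <= p to the hypothesis gives A^* p A <= p.  Write p = h^2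
    with h selfadjoint and y = h A; then y^* y <= h^2 <= |h|^2, whence
    |y| <= |h|.  But h = y A^-1 with |A^-1| < 1, so h = 0, that is p = 0 and
    T x = x.  Conversely T = id makes both sides of the inequality vanish, and
    twice the unit is an admissible A.

    The work lies in the facts on positive elements used here, derived from the
    spectral definition of positivity.  An element a is called norm-positive
    ([npos]) when it is selfadjoint and |s - a| <= s for some real s; such
    elements are obviously closed under sums.  The square root of 1 - t for
    |t| <= 1, a limit of the iteration x |-> (t + x^2) / 2 ([sqrt_exists]),
    shows that norm-positive elements are squares of selfadjoint ones.  The
    inequality |a|^2 <= |a^2 + b^2| for commuting selfadjoint a and b
    ([nrm_sum_sqr]), together with such roots, gives the converse, as well as
    the fact that |c| or -|c| lies in the spectrum of every selfadjoint c
    ([norm_in_spectrum]).  Hence spectral positivity implies norm-positivity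
    ([regular_npos]).

    The remaining point is that x^* x <= s implies |x|^2 <= s
    ([nrm_le_of_sqr_le]), where a lower bound on x^* x has to be found.  Since
    x^* x and x x^* have the same nonzero spectrum, x x^* <= s as well; and
    x^* x + x x^* is half a sum of two selfadjoint squares, so
    x^* x >= - x x^* >= - s. *)

(** * Identities in noncommutative rings *)

Lemma subrDl_eq (V : zmodType) (z x y : V) : z + x - (z + y) = x - y.
Proof. by rewrite opprD addrACA subrr add0r. Qed.

Lemma polarization_eq (V : zmodType) (p q r t : V) :
  p + q + (r + t) - (p - q - (r - t)) = (r + q) + (r + q).
Proof.
rewrite opprB [r - t - _]addrC addrACA subrDl_eq opprK [r + t + _]addrACA.
by rewrite subrr addr0 addrACA (addrC q).
Qed.

Lemma mulr_ACA (S : pzRingType) (a b c x : S) :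
  b * c = c * b -> (a * b) * (c * x) = (a * c) * (b * x).
Proof. by move=> bc; rewrite -!mulrA (mulrA b) bc -mulrA. Qed.

Lemma mulr_subr_addr (S : pzRingType) (a b : S) :
  a * b = b * a -> (a - b) * (a + b) = a * a - b * b.
Proof. by move=> ab; rewrite mulrBl !mulrDr ab opprD addrA addrK. Qed.

Section CStarAlgebra.
Context {R : realType} {A : cstarAlgType R}.
Implicit Types (a b c k t x y : A) (s u : R).
Local Notation "s %:C" := (real_complex R s) : ring_scope.
Local Notation "s %:S" := (s%:C%:A : A) (at level 1, format "s %:S").

(** * The norm as a real number, and the involution *)

(** The norm of the algebra takes its values in R[i]; its real part carries all
    the information and lives in a totally ordered field. *)
Definition nrm a : R := complex.Re `|a|.

Lemma nrmE a : `|a| = (nrm a)%:C.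
Proof. by rewrite /nrm RRe_real // normr_real. Qed.

Lemma nrm_ge0 a : 0 <= nrm a.
Proof. by rewrite -ler0c -nrmE. Qed.

Lemma nrm0 : nrm 0 = 0.
Proof. by rewrite /nrm normr0. Qed.

Lemma nrm_eq0 a : nrm a = 0 -> a = 0.
Proof. by move=> a0; apply/eqP; rewrite -normr_eq0 nrmE a0. Qed.

Lemma nrmN a : nrm (- a) = nrm a.
Proof. by rewrite /nrm normrN. Qed.

Lemma nrmD a b : nrm (a + b) <= nrm a + nrm b.
Proof. by rewrite -lecR rmorphD /= -!nrmE ler_normD. Qed.

Lemma nrmB a b : nrm (a - b) <= nrm a + nrm b.
Proof. by rewrite -(nrmN b) nrmD. Qed.

Lemma nrmM a b : nrm (a * b) <= nrm a * nrm b.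
Proof. by rewrite -lecR rmorphM /= -!nrmE; exact: cstar_normM. Qed.

Lemma nrmZ s a : 0 <= s -> nrm (s%:C *: a) = s * nrm a.
Proof.
move=> s0; apply: (@complexI R); rewrite rmorphM /= -!nrmE normrZ.
by rewrite ger0_norm // ler0c.
Qed.

Lemma starK : involutive (@star R A).
Proof. exact: cstar_starK. Qed.

Lemma starD a b : star (a + b) = star a + star b.
Proof. exact: cstar_starD. Qed.

Lemma starM a b : star (a * b) = star b * star a.
Proof. exact: cstar_starM. Qed.

Lemma starZ (l : R[i]) a : star (l *: a) = (l^*)%C *: star a.
Proof. exact: cstar_starZ. Qed.

Lemma starZr s a : star (s%:C *: a) = s%:C *: star a.
Proof. by rewrite starZ conjc_real. Qed.

Lemma star0 : star 0 = 0 :> A.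
Proof. by have := starZr 0 0; rewrite rmorph0 !scale0r. Qed.

Lemma starN a : star (- a) = - star a.
Proof. by apply: (addrI (star a)); rewrite -starD !subrr star0. Qed.

Lemma star1 : star 1 = 1 :> A.
Proof. by rewrite -[LHS]mulr1 -[X in _ * X]starK -starM mulr1 starK. Qed.

Lemma nrm_starM a : nrm (star a * a) = nrm a ^+ 2.
Proof.
apply: (@complexI R); rewrite rmorphXn /= -!nrmE.
exact: cstar_normE.
Qed.

Lemma nrm_star a : nrm (star a) = nrm a.
Proof.
have le b : nrm b <= nrm (star b).
  have [->|b0] := eqVneq (nrm b) 0; first exact: nrm_ge0.
  have bp : 0 < nrm b by rewrite lt_def b0 nrm_ge0.
  by rewrite -(ler_pM2r bp) -expr2 -nrm_starM nrmM.
by apply/le_anti; rewrite le -{2}(starK a) le.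
Qed.

Lemma nrm_sqr a : selfadjoint a -> nrm (a * a) = nrm a ^+ 2.
Proof. by move=> sa; rewrite -nrm_starM sa. Qed.

Lemma nrm1 : nrm 1 = 1.
Proof.
have : nrm 1 = nrm 1 ^+ 2 by rewrite -nrm_starM star1 mul1r.
have : nrm 1 != 0 by apply/eqP => /nrm_eq0/eqP; rewrite oner_eq0.
by move=> n0 /eqP; rewrite expr2 -{1}[nrm 1]mulr1 (inj_eq (mulfI n0)) => /eqP.
Qed.

(** * Neumann series and square roots *)

(** The real majorant u is monotone and bounded, so f is Cauchy.  The conclusion
    is phrased with del = lim u - u so that an identity between l and other
    elements is obtained by bounding the norm of the difference of its two sides
    by a multiple of del n. *)
Lemma dominated_limit (f : nat -> A) (u : nat -> R) (M : R) :
  (forall n, nrm (f n.+1 - f n) <= u n.+1 - u n) -> (forall n, u n <= M) ->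
  exists l (del : nat -> R),
    [/\ forall n, nrm (l - f n) <= del n,
        forall n, del n.+1 <= del n &
        forall (K : R) z, (forall n, nrm z <= K * del n) -> z = 0].
Proof.
move=> fu uM.
have ndu : nondecreasing_seq u.
  by apply/nondecreasing_seqP => n; rewrite -subr_ge0 (le_trans (nrm_ge0 _) (fu n)).
have cu : u @ \oo --> limn u.
  by apply: nondecreasing_is_cvgn => //; exists M => _ [n _ <-].
have le_lim n : u n <= limn u by apply: nondecreasing_cvgn_le.
have fmn m n : (n <= m)%N -> nrm (f m - f n) <= u m - u n.
  elim: m => [|m IH].
    by rewrite leqn0 => /eqP ->; rewrite !subrr nrm0.
  rewrite leq_eqVlt => /predU1P[->|]; first by rewrite !subrr nrm0.
  rewrite ltnS => /IH h.
  rewrite -(subrKA (f m)) (le_trans (nrmD _ _)) //.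
  by rewrite -[leRHS](subrKA (u m)) lerD ?fu.
have small (e : R) : 0 < e -> exists n, limn u - u n < e.
  move=> e0; have /cvgrPdist_lt/(_ _ e0)[n _ /(_ n)] := cu.
  by move=> /(_ (leqnn n)) /(le_lt_trans (ler_norm _)); exists n.
have cf : cvgn f.
  apply/cauchy_cvgP; apply/cauchy_exP => e e0.
  have er : e = (complex.Re e)%:C by rewrite RRe_real // gtr0_real.
  have /small[n nlt] : 0 < complex.Re e by rewrite -ltcR -er.
  exists (f n); exists n => // m /= nm.
  rewrite -ball_normE /= er -normrN opprB nrmE ltcR.
  by rewrite (le_lt_trans (fmn _ _ nm)) // (le_lt_trans _ nlt) // lerD2r.
exists (limn f), (fun n => limn u - u n); split.
- move=> n; apply/ler_addgt0Pr => e e0.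
  have /cvgrPdist_lt/(_ e%:C)[|N _ /(_ (maxn n N))] := cf.
    by rewrite ltcR.
  move=> /(_ (leq_maxr _ _)) /=; rewrite nrmE ltcR => h.
  rewrite -(subrKA (f (maxn n N))) (le_trans (nrmD _ _)) // addrC lerD //.
    rewrite (le_trans (fmn _ _ (leq_maxl _ _))) // lerD2r //.
  exact: ltW.
- by move=> n; rewrite lerD2l lerN2 ndu.
move=> K z zK; apply: nrm_eq0; apply/le_anti; rewrite nrm_ge0 andbT.
apply/ler_addgt0Pr => e e0; rewrite add0r.
have K1 : 0 < `|K| + 1 by rewrite ltr_wpDl.
have /small[n nlt] : 0 < e / (`|K| + 1) by rewrite divr_gt0.
apply: (le_trans (zK n)).
have d0 : 0 <= limn u - u n by rewrite subr_ge0.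
rewrite ltr_pdivlMr // in nlt.
apply: (le_trans _ (ltW nlt)); rewrite mulrC; apply: ler_wpM2l => //.
by rewrite (le_trans (ler_norm _)) // lerDl.
Qed.

(** The iteration x |-> 1 + t x converges to the inverse; its increments are
    dominated by those of the scalar iteration v |-> 1 + |t| v. *)
Lemma neumann_unit t : nrm t < 1 -> 1 - t \is a GRing.unit.
Proof.
move=> t1; set q := nrm t.
pose f n := iter n (fun x => 1 + t * x) 0.
pose u n := iter n (fun v : R => 1 + q * v) 0.
have fS n : f n.+1 = 1 + t * f n by [].
have uS n : u n.+1 = 1 + q * u n by [].
have q1 : 0 < 1 - q by rewrite subr_gt0.
have q0 : 0 <= q := nrm_ge0 t.
have fu n : nrm (f n.+1 - f n) <= u n.+1 - u n.
  elim: n => [|n IH]; first by rewrite /= !mulr0 !addr0 !subr0 nrm1.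
  rewrite (fS n.+1) [in leLHS]fS (uS n.+1) [in leRHS]uS.
  rewrite !subrDl_eq -!mulrBr.
  by rewrite (le_trans (nrmM _ _)) // ler_wpM2l.
have uM n : u n <= (1 - q)^-1.
  elim: n => [|n IH]; first by rewrite /= invr_ge0 ltW.
  have -> : (1 - q)^-1 = 1 + q * (1 - q)^-1 by field; rewrite gt_eqF.
  by rewrite uS lerD2l ler_wpM2l.
have [l [del [lf ndel lz]]] := dominated_limit fu uM.
have cf n : f n * t = t * f n.
  elim: n => [|n IH]; first by rewrite mulr0 mul0r.
  by rewrite fS mulrDl mulrDr mul1r mulr1 -mulrA IH.
have tl : l * t = t * l.
  apply/eqP; rewrite -subr_eq0; apply/eqP/(lz (q + q)) => n.
  have -> : l * t - t * l = (l - f n) * t - t * (l - f n).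
    by rewrite mulrBl mulrBr cf opprB addrA subrK.
  rewrite (le_trans (nrmB _ _)) // [leRHS]mulrDl lerD //.
    rewrite (le_trans (nrmM _ _)) // mulrC ler_wpM2l //.
  by rewrite (le_trans (nrmM _ _)) // ler_wpM2l.
have l1 : l - t * l = 1.
  apply/eqP; rewrite -subr_eq0; apply/eqP/(lz (1 + q)) => n.
  have -> : l - t * l - 1 = (l - f n.+1) - t * (l - f n).
    by rewrite fS mulrBr opprB opprD !addrA subrK addrAC.
  rewrite (le_trans (nrmB _ _)) // [leRHS]mulrDl mul1r lerD //.
    exact: le_trans (lf _) (ndel _).
  by rewrite (le_trans (nrmM _ _)) // ler_wpM2l.
apply/unitrP; exists l.
by rewrite mulrBl mulrBr mul1r mulr1 tl.
Qed.

Lemma scale2_half x : 2^-1%:C *: (x + x) = x.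
Proof.
rewrite -[x in x + _]scale1r -[x in _ + x]scale1r -scalerDl scalerA.
have -> : 1 + 1 = 2%:C :> R[i] by rewrite -[2]/(1 + 1) rmorphD /= rmorph1.
by rewrite -rmorphM /= mulVf ?pnatr_eq0 // rmorph1 scale1r.
Qed.

(** If l = (t + l^2) / 2 then (1 - l)^2 = 1 - t.  The iteration x |-> (t + x^2) / 2
    from 0 is dominated by the same one with t replaced by 1, which increases
    and stays below 1, so the boundary case |t| = 1 is covered.  The root
    commutes with the commutant of t, as all iterates do. *)
Lemma sqrt_exists t : selfadjoint t -> nrm t <= 1 ->
  exists k, [/\ selfadjoint k, k * k = 1 - t &
                forall c, c * t = t * c -> c * k = k * c].
Proof.
move=> st t1.
pose f n := iter n (fun x => 2^-1%:C *: (t + x * x)) 0.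
pose u n := iter n (fun v : R => 2^-1 * (1 + v * v)) 0.
have fS n : f n.+1 = 2^-1%:C *: (t + f n * f n) by [].
have uS n : u n.+1 = 2^-1 * (1 + u n * u n) by [].
have h0 : 0 <= 2^-1 :> R by rewrite invr_ge0.
have u01 n : 0 <= u n <= 1.
  elim: n => [|n /andP[un0 un1]]; first by rewrite lexx ler01.
  rewrite uS; apply/andP; split; nra.
have nf n : nrm (f n) <= u n.
  elim: n => [|n IH]; first by rewrite nrm0.
  rewrite fS nrmZ // uS ler_wpM2l // (le_trans (nrmD _ _)) // lerD //.
  by rewrite (le_trans (nrmM _ _)) // ler_pM ?nrm_ge0.
have fu n : nrm (f n.+1 - f n) <= u n.+1 - u n.
  elim: n => [|n IH].
    by rewrite /= !mulr0 !addr0 !subr0 nrmZ // mulr1 ler_piMr.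
  rewrite (fS n.+1) [in leLHS]fS (uS n.+1) [in leRHS]uS.
  rewrite -scalerBr -mulrBr nrmZ // ler_wpM2l // !subrDl_eq.
  have -> : f n.+1 * f n.+1 - f n * f n =
      f n.+1 * (f n.+1 - f n) + (f n.+1 - f n) * f n.
    by rewrite mulrBr mulrBl addrA subrK.
  rewrite (le_trans (nrmD _ _)) //.
  have -> : u n.+1 * u n.+1 - u n * u n =
    u n.+1 * (u n.+1 - u n) + (u n.+1 - u n) * u n by ring.
  by rewrite lerD // (le_trans (nrmM _ _)) // ler_pM ?nrm_ge0.
have uM n : u n <= 1 by case/andP: (u01 n).
have [l [del [lf ndel lz]]] := dominated_limit fu uM.
have sf n : star (f n) = f n.
  elim: n => [|n IH]; first exact: star0.
  by rewrite fS starZr starD starM IH st.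
have sl : star l = l.
  apply/eqP; rewrite -subr_eq0; apply/eqP/(lz 2) => n.
  have -> : star l - l = star (l - f n) - (l - f n).
    by rewrite starD starN sf opprB addrA subrK.
  by rewrite (le_trans (nrmB _ _)) // nrm_star mulr2n [leRHS]mulrDl mul1r lerD.
have ll : l + l = t + l * l.
  apply/eqP; rewrite -subr_eq0; apply/eqP/(lz (2 + (nrm l + 1))) => n.
  have -> : l + l - (t + l * l) =
      (l - f n.+1) + (l - f n.+1) - (l * (l - f n) + (l - f n) * f n).
    have -> : l * (l - f n) + (l - f n) * f n = l * l - f n * f n.
      by rewrite mulrBr mulrBl addrA subrK.
    have -> : l - f n.+1 + (l - f n.+1) = l + l - (t + f n * f n).
      by rewrite addrACA -opprD fS -scalerDr scale2_half.
    by rewrite !opprD opprK !addrA [RHS]addrAC addrNK.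
  rewrite (le_trans (nrmB _ _)) // [leRHS]mulrDl lerD //.
    rewrite (le_trans (nrmD _ _)) // mulr2n [leRHS]mulrDl mul1r.
    by rewrite lerD // (le_trans (lf _)).
  rewrite (le_trans (nrmD _ _)) // [leRHS]mulrDl lerD //.
    by rewrite (le_trans (nrmM _ _)) // ler_wpM2l ?nrm_ge0.
  rewrite (le_trans (nrmM _ _)) // mulrC ler_pM ?nrm_ge0 //.
  by rewrite (le_trans (nf n)).
exists (1 - l); split.
- by rewrite /selfadjoint starD starN star1 sl.
- have tE : t = l + l - l * l by rewrite ll addrK.
  by rewrite [in RHS]tE mulrBl mul1r mulrBr mulr1 -!addrA -opprD.
move=> c ct; rewrite mulrBl mulrBr mul1r mulr1; congr (_ - _).
have cf n : c * f n = f n * c.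
  elim: n => [|n IH]; first by rewrite mulr0 mul0r.
  by rewrite fS -scalerAr -scalerAl mulrDl mulrDr ct mulrA IH -mulrA IH mulrA.
apply/eqP; rewrite -subr_eq0; apply/eqP/(lz (nrm c + nrm c)) => n.
have -> : c * l - l * c = c * (l - f n) - (l - f n) * c.
  by rewrite mulrBl mulrBr cf opprB addrA subrK.
rewrite (le_trans (nrmB _ _)) // [leRHS]mulrDl lerD //.
  by rewrite (le_trans (nrmM _ _)) // ler_wpM2l // nrm_ge0.
by rewrite (le_trans (nrmM _ _)) // mulrC ler_wpM2l // nrm_ge0.
Qed.

(** With w = a + i b one has w^* w = a^2 + b^2, while 2 a = w + w^* has norm
    at most 2 |w|. *)
Lemma nrm_sum_sqr a b : selfadjoint a -> selfadjoint b -> a * b = b * a ->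
  nrm a ^+ 2 <= nrm (a * a + b * b).
Proof.
move=> sa sb ab.
pose i : R[i] := 'i%C; pose w := a + i *: b.
have ic : (i^*)%C = - i by rewrite /i /=; congr (_ +i* _)%C; rewrite oppr0.
have sw : star w = a - i *: b by rewrite starD starZ ic sa sb scaleNr.
have -> : a * a + b * b = star w * w.
  have ay : a * (i *: b) = (i *: b) * a by rewrite -scalerAr ab scalerAl.
  have yy : (i *: b) * (i *: b) = - (b * b).
    by rewrite -scalerAl -scalerAr scalerA -expr2 sqr_i scaleN1r.
  by rewrite sw mulrBl !mulrDr ay yy opprD addrA addrK opprK.
rewrite nrm_starM ler_sqr ?nnegrE ?nrm_ge0 //.
have -> : a = 2^-1%:C *: (w + star w) by rewrite sw addrACA subrr addr0 scale2_half.
rewrite nrmZ ?invr_ge0 // -(ler_pM2l (ltr0n _ 2)) mulrA divff ?pnatr_eq0 // mul1r.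
by rewrite (le_trans (nrmD _ _)) // nrm_star mulr2n [leRHS]mulrDl mul1r.
Qed.

(** * Real scalars in the algebra *)

Lemma scB s u : (s - u)%:S = s%:S - u%:S.
Proof. by rewrite rmorphB /= scalerBl. Qed.

Lemma scD s u : (s + u)%:S = s%:S + u%:S.
Proof. by rewrite rmorphD /= scalerDl. Qed.

Lemma scM s u : (s * u)%:S = s%:S * u%:S.
Proof. by rewrite rmorphM /= mulr_algl scalerA. Qed.

Lemma sc0 : 0%:S = 0.
Proof. by rewrite rmorph0 scale0r. Qed.

Lemma sc1 : 1%:S = 1.
Proof. by rewrite rmorph1 scale1r. Qed.

Lemma sc_comm s a : a * s%:S = s%:S * a.
Proof. by rewrite mulr_algl mulr_algr. Qed.

Lemma sc_star s : star (s%:S) = s%:S.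
Proof. by rewrite starZr star1. Qed.

Lemma nrm_sc s : 0 <= s -> nrm (s%:S) = s.
Proof. by move=> s0; rewrite nrmZ // nrm1 mulr1. Qed.

Lemma sc_unit s : s != 0 -> s%:S \is a GRing.unit.
Proof.
move=> s0; apply/unitrP; exists (s^-1)%:S.
by rewrite -!scM mulVf // divff // sc1.
Qed.

Lemma neumann_sc_unit s t : nrm t < s -> s%:S - t \is a GRing.unit.
Proof.
move=> ts; have s0 : 0 < s := le_lt_trans (nrm_ge0 t) ts.
have -> : s%:S - t = s%:S * (1 - (s^-1)%:S * t).
  by rewrite mulrBr mulr1 mulrA -scM divff ?gt_eqF // sc1 mul1r.
rewrite unitrMl ?sc_unit ?gt_eqF //; apply: neumann_unit.
by rewrite mulr_algl nrmZ ?invr_ge0 ?(ltW s0) // mulrC ltr_pdivrMr // mul1r.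
Qed.

Lemma sqrt_sc_exists s t : selfadjoint t -> nrm t <= s ->
  exists k, [/\ selfadjoint k, k * k = s%:S - t &
                forall c, c * t = t * c -> c * k = k * c].
Proof.
move=> st ts; have [s0|s0] := eqVneq s 0.
  have -> : t = 0 by apply/nrm_eq0/le_anti; rewrite nrm_ge0 -s0 ts.
  exists 0; split; first exact: star0; first by rewrite s0 sc0 subr0 mulr0.
  by move=> c _; rewrite mulr0 mul0r.
have sp : 0 < s by rewrite lt_def s0 (le_trans (nrm_ge0 t) ts).
have [k [sk kk ck]] : exists k, [/\ selfadjoint k,
    k * k = 1 - (s^-1)%:C *: t &
    forall c, c * ((s^-1)%:C *: t) = ((s^-1)%:C *: t) * c -> c * k = k * c].
  apply: sqrt_exists; first by rewrite /selfadjoint starZr st.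
  by rewrite nrmZ ?invr_ge0 ?(ltW sp) // mulrC ler_pdivrMr // mul1r.
exists ((Num.sqrt s)%:C *: k); split.
- by rewrite /selfadjoint starZr sk.
- rewrite -scalerAl -scalerAr scalerA kk -rmorphM /= -expr2 sqr_sqrtr ?(ltW sp) //.
  by rewrite scalerBr scalerA -rmorphM /= divff // rmorph1 scale1r.
move=> c ct; rewrite -scalerAr -scalerAl ck //.
by rewrite -scalerAr -scalerAl ct.
Qed.

(** * The norm of a selfadjoint element and its spectrum *)

(** Let s = |c|.  If s - c and s + c are invertible, then s^2 - c^2 = k^2 with k
    invertible.  Put M = |k^-1| and m^2 = M^2 - k^-2.  Then (k m)^2 = M^2 k^2 - 1,
    so (M c)^2 + (k m)^2 is the scalar M^2 s^2 - 1, smaller than |M c|^2: this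
    contradicts [nrm_sum_sqr]. *)
Lemma norm_in_spectrum c : selfadjoint c -> 0 < nrm c ->
  (nrm c)%:S - c \is a GRing.unit -> (nrm c)%:S + c \is a GRing.unit -> False.
Proof.
move=> sc c0 um up; set s := nrm c in c0 um up.
have cc : nrm (c * c) = s ^+ 2 by apply: nrm_sqr.
have [k [sk kk ck]] : exists k, [/\ selfadjoint k, k * k = (s ^+ 2)%:S - c * c &
    forall b, b * (c * c) = (c * c) * b -> b * k = k * b].
  by apply: sqrt_sc_exists; rewrite ?cc // /selfadjoint starM sc.
have uk : k * k \is a GRing.unit.
  have -> : k * k = (s%:S - c) * (s%:S + c).
    by rewrite kk mulr_subr_addr -?sc_comm // -scM.
  by rewrite unitrMl.
have {}uk : k \is a GRing.unit.
  apply/unitrP; exists ((k * k)^-1 * k); split; first by rewrite -mulrA mulVr.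
  have kkk : k * (k * k) = (k * k) * k by rewrite mulrA.
  by rewrite mulrA (commrV (kkk : GRing.comm _ _)) -mulrA mulVr.
set g := k^-1; set M := nrm g.
have sg : star g = g.
  by rewrite -[LHS]mul1r -(mulVr uk) -mulrA -{2}sk -starM mulVr // star1 mulr1.
have kc : c * k = k * c by apply: ck; rewrite mulrA.
have gc : c * g = g * c by apply: (commrV (kc : GRing.comm _ _)).
have gk : k * g = g * k by rewrite mulrV ?mulVr.
have [m [sm mm cm]] : exists m, [/\ selfadjoint m, m * m = (M ^+ 2)%:S - g * g &
    forall b, b * (g * g) = (g * g) * b -> b * m = m * b].
  by apply: sqrt_sc_exists; rewrite ?nrm_sqr // /selfadjoint starM sg.
have km : k * m = m * k by apply/cm/commrM.
have mc : c * m = m * c by apply/cm/commrM.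
have sumE : (M%:S * c) * (M%:S * c) + (k * m) * (k * m) = (M ^+ 2 * s ^+ 2 - 1)%:S.
  have -> : (k * m) * (k * m) = (k * k) * (m * m).
    by rewrite mulr_ACA.
  have -> : k * k * (m * m) = (M ^+ 2)%:S * (k * k) - 1.
    rewrite mm mulrBr sc_comm; congr (_ - _).
    by rewrite -mulrA (mulrA k g) mulrV // mul1r mulrV.
  have -> : (M%:S * c) * (M%:S * c) = (M ^+ 2)%:S * (c * c).
    by rewrite mulr_ACA ?sc_comm // -scM.
  by rewrite addrA -mulrDr kk [c * c + _]addrC subrK scB scM sc1.
have M0 : 0 <= M by apply: nrm_ge0.
have ks : nrm k ^+ 2 <= s ^+ 2.
  have -> : s ^+ 2 = nrm (k * k + c * c).
    by rewrite kk subrK nrm_sc // sqr_ge0.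
  by apply: nrm_sum_sqr.
have kM : 1 <= nrm k * M by rewrite -nrm1 -(mulrV uk) nrmM.
(* as a scalar, M ^+ 2 * s ^+ 2 - 1 is then its own norm *)
have ge1 : 1 <= M ^+ 2 * s ^+ 2.
  rewrite -(expr1n R 2) (le_trans _ (ler_wpM2l (sqr_ge0 _) ks)) //.
  by rewrite -exprMn mulrC ler_sqr ?nnegrE ?mulr_ge0 ?nrm_ge0.
have : nrm (M%:S * c) ^+ 2 <= nrm ((M ^+ 2 * s ^+ 2 - 1)%:S).
  rewrite -sumE; apply: nrm_sum_sqr.
  - by rewrite /selfadjoint starM sc_star sc sc_comm.
  - by rewrite /selfadjoint starM sk sm km.
  by rewrite -mulrA (commrM kc mc : c * (k * m) = k * m * c) mulrA -sc_comm -mulrA.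
rewrite nrm_sc ?subr_ge0 // mulr_algl nrmZ // exprMn.
by rewrite lerBrDr gerDl ler10.
Qed.

(** * Norm-positive elements *)

(** Equivalent to [cstar_pos], but visibly closed under sums. *)
Definition npos a : Prop := selfadjoint a /\ exists s, nrm (s%:S - a) <= s.

Lemma nposD a b : npos a -> npos b -> npos (a + b).
Proof.
move=> [sa [s as_]] [sb [u bu]]; split; first by rewrite /selfadjoint starD sa sb.
exists (s + u); rewrite scD opprD addrACA (le_trans (nrmD _ _)) // lerD //.
Qed.

Lemma nposZ s a : 0 <= s -> npos a -> npos (s%:C *: a).
Proof.
move=> s0 [sa [u au]]; split; first by rewrite /selfadjoint starZr sa.
by exists (s * u); rewrite rmorphM /= -scalerA -scalerBr nrmZ // ler_wpM2l.
Qed.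

Lemma npos_sqrt a : npos a ->
  exists k, [/\ selfadjoint k, k * k = a & forall c, c * a = a * c -> c * k = k * c].
Proof.
move=> [sa [s as_]].
have ssa : selfadjoint (s%:S - a) by rewrite /selfadjoint starD starN sc_star sa.
have [k [sk kk ck]] := sqrt_sc_exists ssa as_.
exists k; split=> //; first by rewrite kk subKr.
by move=> c ca; apply: ck; rewrite mulrBl mulrBr ca sc_comm.
Qed.

(** With m^2 = |k|^2 - k^2, [nrm_sum_sqr] bounds |m^2| by |m^2 + k^2| = |k|^2. *)
Lemma npos_sqr k : selfadjoint k -> npos (k * k).
Proof.
move=> sk; split; first by rewrite /selfadjoint starM sk.
exists (nrm k ^+ 2).
have skk : selfadjoint (k * k) by rewrite /selfadjoint starM sk.
have [|m [sm mm cm]] := @sqrt_sc_exists (nrm k ^+ 2) _ skk; first by rewrite nrm_sqr.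
rewrite -mm nrm_sqr //.
have -> : nrm k ^+ 2 = nrm (m * m + k * k).
  by rewrite mm subrK nrm_sc // sqr_ge0.
by apply: nrm_sum_sqr => //; apply/esym/cm; rewrite mulrA.
Qed.

Lemma npos_sub_nrm k : selfadjoint k -> npos ((nrm k ^+ 2)%:S - k * k).
Proof.
move=> sk; split; first by rewrite /selfadjoint starD starN sc_star starM sk.
by exists (nrm k ^+ 2); rewrite subKr nrm_sqr.
Qed.

Lemma npos_unit a u : npos a -> 0 < u -> a + u%:S \is a GRing.unit.
Proof.
move=> [_ [s as_]] u0.
have -> : a + u%:S = (s + u)%:S - (s%:S - a).
  by rewrite scD subrDl_eq opprK addrC.
by apply: neumann_sc_unit; rewrite (le_lt_trans as_) // ltrDl.
Qed.

(** Only the negative part of the spectrum matters.  If c = |a| - a had norm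
    greater than |a|, then |c| - c = a + (|c| - |a|) would be invertible by
    hypothesis and |c| + c = (|c| + |a|) - a by the Neumann series, against
    [norm_in_spectrum]. *)
Lemma regular_npos a : selfadjoint a ->
  (forall u, 0 < u -> a + u%:S \is a GRing.unit) -> npos a.
Proof.
move=> sa ua; split=> //; exists (nrm a).
set c := (nrm a)%:S - a; rewrite leNgt; apply/negP => lt.
have sc : selfadjoint c by rewrite /selfadjoint starD starN sc_star sa.
apply: (norm_in_spectrum sc); first exact: le_lt_trans (nrm_ge0 _) lt.
  have -> : (nrm c)%:S - c = a + (nrm c - nrm a)%:S.
    by rewrite /c opprB scB addrCA.
  by apply: ua; rewrite subr_gt0.
have -> : (nrm c)%:S + c = (nrm c + nrm a)%:S - a by rewrite scD addrA.
by apply: neumann_sc_unit; rewrite ltr_pwDl // (le_lt_trans (nrm_ge0 a)).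
Qed.

(** The nonzero spectra of x y and y x coincide: if G inverts s - x y, then
    s^-1 (1 + y G x) inverts s - y x. *)
Lemma unit_swap s x y : s != 0 ->
  s%:S - x * y \is a GRing.unit -> s%:S - y * x \is a GRing.unit.
Proof.
move=> s0 uxy; set G := (s%:S - x * y)^-1; pose z := 1 + y * G * x.
have z1 : (s%:S - y * x) * z = s%:S.
  have -> : (s%:S - y * x) * z = s%:S - y * x + y * ((s%:S - x * y) * G) * x.
    rewrite /z mulrDr mulr1 mulrBl; congr (_ + _).
    by rewrite [in RHS]mulrBl mulrBr mulrBl !mulrA sc_comm.
  by rewrite mulrV // mulr1 subrK.
have z2 : z * (s%:S - y * x) = s%:S.
  have -> : z * (s%:S - y * x) = s%:S - y * x + y * (G * (s%:S - x * y)) * x.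
    rewrite /z mulrDl mul1r; congr (_ + _).
    rewrite mulrBr; rewrite [in RHS]mulrBr mulrBr mulrBl !mulrA.
    by rewrite sc_comm -(mulrA _ _%:S x) -(sc_comm _ x) !mulrA sc_comm !mulrA.
  by rewrite mulVr // mulr1 subrK.
apply/unitrP; exists ((s^-1)%:S * z); split.
  by rewrite -mulrA z2 -scM mulVf // sc1.
by rewrite -sc_comm mulrA z1 -scM divff // sc1.
Qed.

Lemma npos_swap s x : 0 < s -> npos (s%:S - star x * x) -> npos (s%:S - x * star x).
Proof.
move=> s0 px; apply: regular_npos.
  by rewrite /selfadjoint starD starN sc_star starM starK.
move=> u u0; rewrite addrAC -scD; apply: unit_swap.
  by rewrite gt_eqF // addr_gt0.
by rewrite scD addrAC; apply: npos_unit.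
Qed.

(** With y = star x, twice this element is (x + y)^2 + (i (x - y))^2. *)
Lemma npos_sum_star x : npos (star x * x + x * star x).
Proof.
pose P := x + star x; pose Q := 'i%C *: (x - star x).
have ic : (('i%C : R[i])^*)%C = - 'i%C by congr (_ +i* _)%C; rewrite oppr0.
have sP : selfadjoint P by rewrite /selfadjoint starD starK addrC.
have sQ : selfadjoint Q.
  by rewrite /selfadjoint starZ starD starN starK ic scaleNr -scalerN opprB.
have QQ : Q * Q = - ((x - star x) * (x - star x)).
  by rewrite -scalerAl -scalerAr scalerA -expr2 sqr_i scaleN1r.
have -> : star x * x + x * star x = 2^-1%:C *: (P * P + Q * Q).
  rewrite QQ -[LHS]scale2_half; congr (_ *: _); rewrite /P.
  by rewrite mulrDl mulrBl !mulrDr !mulrN polarization_eq.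
by apply: nposZ; rewrite ?invr_ge0 //; apply: nposD; apply: npos_sqr.
Qed.

(** Write e = x^* x.  Both s - e and s + e are norm-positive, the second because
    s + e is the sum of s - x x^* and of x^* x + x x^*.  Their square roots u, v
    commute and satisfy e^2 + (u v)^2 = s^2, whence |e| <= s. *)
Lemma nrm_le_of_sqr_le s x : 0 < s -> npos (s%:S - star x * x) -> nrm x ^+ 2 <= s.
Proof.
move=> s0 px; set e := star x * x.
have pe : npos (s%:S + e).
  have -> : s%:S + e = (s%:S - x * star x) + (star x * x + x * star x).
    by rewrite (addrC (star x * x)) addrA subrK.
  exact: nposD (npos_swap s0 px) (npos_sum_star x).
have [u [su uu cu]] := npos_sqrt px.
have [v [sv vv cv]] := npos_sqrt pe.
have eu : e * u = u * e by apply: cu; rewrite mulrBl mulrBr sc_comm.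
have ev : e * v = v * e by apply: cv; rewrite mulrDl mulrDr sc_comm.
have uv : u * v = v * u by apply: cv; rewrite mulrDl mulrDr sc_comm eu.
have se : selfadjoint e by rewrite /selfadjoint starM starK.
have : nrm e ^+ 2 <= nrm (e * e + (u * v) * (u * v)).
  apply: nrm_sum_sqr => //; first by rewrite /selfadjoint starM su sv uv.
  by rewrite mulrA eu -mulrA ev mulrA.
have -> : (u * v) * (u * v) = (u * u) * (v * v).
  by rewrite mulr_ACA.
have -> : e * e + u * u * (v * v) = (s ^+ 2)%:S.
  by rewrite uu vv mulr_subr_addr -?sc_comm // addrC subrK -scM.
rewrite nrm_sc ?sqr_ge0 // ler_sqr ?nnegrE ?nrm_ge0 ?(ltW s0) //.
by rewrite nrm_starM.
Qed.

(** * Comparison with spectral positivity, and the theorem *)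

Lemma cstar_pos_npos a : cstar_pos a -> npos a.
Proof.
move=> [sa pa]; apply: regular_npos => // u u0.
rewrite -unitrN; apply: contraPT (u0) => nu.
have /pa : spectrum a (- u%:C).
  by rewrite /spectrum /= scaleNr -opprD addrC.
by rewrite /= -rmorphN /= ler0c oppr_ge0 => /le_lt_trans h /h; rewrite ltxx.
Qed.

Lemma cstar_pos0 : cstar_pos (0 : A).
Proof.
split=> [|l]; first exact: star0.
rewrite /spectrum /= subr0 => nu; have [->|l0] := eqVneq l 0; first exact: lexx.
case/negP: nu; apply/unitrP; exists (l^-1)%:A.
by rewrite !mulr_algl !scalerA mulVf // mulfV // scale1r.
Qed.

(** With p = h^2 and y = h B, the hypothesis reads y^* y <= h^2 <= |h|^2, so
    |y| <= |h|; but |h| <= |y| |B^-1|. *)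
Lemma conj_le_eq0 (B p : A) : B \is a GRing.unit -> `|B^-1| < 1 ->
  npos p -> npos (p - star B * p * B) -> p = 0.
Proof.
move=> uB B1 pp pc; have {}B1 : nrm B^-1 < 1 by rewrite -ltcR -nrmE.
have [h [sh hh _]] := npos_sqrt pp.
suff h0 : nrm h = 0 by rewrite -hh (nrm_eq0 h0) mulr0.
apply/eqP/contraT => hn0; have hp : 0 < nrm h by rewrite lt_def hn0 nrm_ge0.
pose y := h * B.
have yh : nrm y <= nrm h.
  rewrite -ler_sqr ?nnegrE ?nrm_ge0 //; apply: nrm_le_of_sqr_le; rewrite ?exprn_gt0 //.
  have -> : star y * y = star B * p * B by rewrite starM sh -hh !mulrA.
  rewrite -[X in npos X](subrKA p); apply: nposD pc.
  by rewrite -hh; apply: npos_sub_nrm.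
have : nrm h <= nrm y * nrm B^-1 by rewrite -{1}(mulrK uB h) nrmM.
rewrite leNgt => /negP[]; rewrite (le_lt_trans (ler_wpM2r (nrm_ge0 _) yh)) //.
by rewrite gtr_pMr.
Qed.
End CStarAlgebra.

Theorem theorem8 (R : realType) (AA : cstarAlgType R) (X : Type)
    (d : X -> X -> AA) (hd : cstar_metric d)
    (x0 : X) (r : AA) (hr : cstar_pos r) (T : X -> X) :
  let phi : X -> AA := fun x => d x x0 in
  (forall A : AA, A \is a GRing.unit -> `|A^-1| < 1 ->
     ((forall x, cstar_le (star A * d x (T x) * A) (phi x - phi (T x)))
      <-> (fixes_circle d x0 r T /\ T = id)))
  /\
  ((exists A : AA, [/\ A \is a GRing.unit, `|A^-1| < 1 &
      forall x, cstar_le (star A * d x (T x) * A) (phi x - phi (T x))])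
   <-> (fixes_circle d x0 r T /\ T = id)).
Proof.
move=> phi.
have fwd (A : AA) : A \is a GRing.unit -> `|A^-1| < 1 ->
    (forall x, cstar_le (star A * d x (T x) * A) (phi x - phi (T x))) ->
    fixes_circle d x0 r T /\ T = id.
  move=> uA A1 le_phi; suff Tid : T = id by split=> //; rewrite Tid.
  apply/funext => x; apply/esym/(cstar_metric_eq0 hd).
  apply: (conj_le_eq0 uA A1); first exact/cstar_pos_npos/(cstar_metric_ge0 hd).
  have := nposD (cstar_pos_npos (cstar_metric_triangle hd x x0 (T x)))
    (cstar_pos_npos (le_phi x)).
  congr npos; rewrite /phi addrA; congr (_ - _).
  by rewrite addrA subrK addrK.
have bwd (A : AA) : T = id ->
    forall x, cstar_le (star A * d x (T x) * A) (phi x - phi (T x)).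
  move=> -> x; rewrite /cstar_le subrr (_ : d x x = 0) ?mulr0 ?mul0r ?subr0.
    exact: cstar_pos0.
  exact/(cstar_metric_eq0 hd).
split=> [A uA A1|]; first by split=> [|[_ /(bwd A)]//]; exact: fwd.
split=> [[A [uA A1]]|[fT Tid]]; first exact: fwd.
(* any scalar of modulus greater than 1 would do *)
pose two := (real_complex R 2)%:A : AA.
have two_unit : two \is a GRing.unit by rewrite sc_unit ?pnatr_eq0.
have inv2 : two^-1 = (real_complex R 2^-1)%:A.
  apply: (mulrI two_unit).
  by rewrite mulrV // -scM divff ?pnatr_eq0 // sc1.
exists two; split; [|rewrite inv2 nrmE nrm_sc|exact: bwd].
- exact: two_unit.
- by rewrite ltcR invf_lt1 ?ltr1n ?ltr0n.
by rewrite invr_ge0.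
Qed.
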